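(* Let $0<\gamma<R_{\mathcal M}$ and set $n_j:=2^j$, $R_j:=\gamma n_j^{-1}$ for $j\ge0$. There exists a sequence of finite subsets $\{\boldsymbol X_j\}_{j\ge0}$ of $\mathcal M$ such that, for any $j\ge0$, $$\boldsymbol X_j\subset\boldsymbol X_{j+1},$$ and $$h_{\boldsymbol X_j}\le R_j,\qquad\operatorname{sep}(\boldsymbol X_j)\ge R_j,\qquad|\boldsymbol X_j|\asymp R_j^{-d}\asymp\gamma^{-d}2^{jd}.$$ The constants in $\asymp$ depend only on $\mathcal M$.
   Context: $(\mathcal M,g)$ is a compact, connected, $d$-dimensional smooth Riemannian manifold without boundary, $\mu$ its Riemannian volume measure normalized so that $\mu(\mathcal M)=1$, $\operatorname{dist}$ the geodesic distance, $B(x,R)=\{y:\operatorname{dist}(x,y)\le R\}$. Constants $R_{\mathcal M},c_1,c_2>0$ depending only on $\mathcal M$ are fixed such that $c_1R^d\le\mu(B(x,R))\le c_2R^d$ for all $x\in\mathcal M$, $0<R\le R_{\mathcal M}$. For a finite set $\boldsymbol X\subset\mathcal M$: mesh norm $h_{\boldsymbol X}=\sup_{y\in\mathcal M}\min_{x\in\boldsymbol X}\operatorname{dist}(y,x)$; separation distance $\operatorname{sep}(\boldsymbol X)=\min_{x\ne y\in\boldsymbol X}\operatorname{dist}(x,y)$ (with the convention $+\infty$ for a one-point set). $A\asymp B$ means each is bounded by a positive constant times the other. *)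

(* Defs.v *)
From HB Require Import structures.
From mathcomp Require Import all_boot all_order all_algebra finmap.
From mathcomp Require Import all_classical all_reals all_analysis.

Set Implicit Arguments.
Unset Strict Implicit.
Unset Printing Implicit Defensive.

Import Order.TTheory GRing.Theory Num.Theory.
Import numFieldNormedType.Exports.

Local Open Scope classical_set_scope.
Local Open Scope ring_scope.

Notation borel M := (g_sigma_algebraType (@open M)).

Section calculus.
Variable R : realType.

(* Meant for open U: f is C^(k+1) when it is differentiable with C^k partial
   derivatives. *)
Fixpoint Ck_on (d : nat) (W : normedModType R) (k : nat) (U : set 'rV[R]_d)
    (f : 'rV[R]_d -> W) : Prop :=
  match k with
  | 0 => forall x, U x -> {for x, continuous f}
  | k'.+1 => (forall x, U x -> differentiable f x) /\
             (forall i : 'I_d, Ck_on k' U ('D_(delta_mx 0 i) f))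
  end.

Definition smooth_on (d : nat) (W : normedModType R) (U : set 'rV[R]_d)
    (f : 'rV[R]_d -> W) : Prop := forall k, Ck_on k U f.

Definition C1_curve (d : nat) (u : R -> 'rV[R]_d) : Prop :=
  (forall t, derivable u t 1) /\ continuous (derive1 u).

(* The Lebesgue integral over R^d of a nonnegative Borel function, as the
   iterated integral over the coordinates (Tonelli). *)
Fixpoint lebesgue_int (d : nat) : ('rV[R]_d -> \bar R) -> \bar R :=
  match d with
  | 0 => fun f => f 0
  | d'.+1 => fun f =>
      (\int[@lebesgue_measure R]_x
         lebesgue_int (fun v : 'rV[R]_d' => f (row_mx x%:M v)))%E
  end.

End calculus.

Record smooth_manifold (R : realType) (d : nat) (M : topologicalType) := {
  index : Type ;
  dom : index -> set M ;
  chart : index -> M -> 'rV[R]_d ;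
  chart_inv : index -> 'rV[R]_d -> M ;
  manifold_hausdorff : hausdorff_space M ;
  manifold_second_countable : @second_countable M ;
  dom_open : forall i, open (dom i) ;
  dom_cover : forall x, exists i, dom i x ;
  codom_open : forall i, open (chart i @` dom i) ;
  chartK : forall i x, dom i x -> chart_inv i (chart i x) = x ;
  chart_continuous : forall i x, dom i x -> {for x, continuous (chart i)} ;
  chart_inv_continuous : forall i x, dom i x ->
    {for chart i x, continuous (chart_inv i)} ;
  transition_smooth : forall i j,
    smooth_on (chart i @` (dom i `&` dom j)) (chart j \o chart_inv i)
}.

Record riemannian_metric (R : realType) (d : nat) (M : topologicalType)
    (S : smooth_manifold R d M) := {
  (* gram i v is the matrix of the metric in the chart i, at the point of
     coordinates v; tangent vectors are row vectors. *)
  gram : index S -> 'rV[R]_d -> 'M[R]_d ;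
  gram_smooth : forall i, smooth_on (chart i @` dom i) (gram i) ;
  gram_sym : forall i x, dom i x -> (gram i (chart i x))^T = gram i (chart i x) ;
  gram_posdef : forall i x, dom i x -> forall v : 'rV[R]_d, v != 0 ->
    0 < (v *m gram i (chart i x) *m v^T) 0 0 ;
  gram_transition : forall i j x, dom i x -> dom j x ->
    let J := 'J (chart j \o chart_inv i) (chart i x) in
    gram i (chart i x) = J *m gram j (chart j x) *m J^T
}.

Section riemannian.
Variables (R : realType) (d : nat) (M : topologicalType).
Variables (S : smooth_manifold R d M) (g : riemannian_metric S).

(* curve_length c a b L: c restricted to [a, b] is a piecewise C^1 curve and L
   is its length. The subdivision is taken fine enough for each piece to lie in
   one chart; there the coordinates of c coincide with a C^1 function u on R
   (C^1 on a compact interval is the same as having a C^1 extension). *)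
Inductive curve_length (c : R -> M) : R -> R -> \bar R -> Prop :=
| curve_length_pt a : curve_length c a a 0%E
| curve_length_cons i (u : R -> 'rV[R]_d) a b e L :
    a <= b -> C1_curve u ->
    (forall t, a <= t <= b -> dom (s := S) i (c t) /\ chart i (c t) = u t) ->
    curve_length c b e L ->
    curve_length c a e
      (\int[@lebesgue_measure R]_(t in `[a, b])
         (Num.sqrt ((derive1 u t *m gram g i (u t) *m (derive1 u t)^T) 0 0))%:E + L)%E.

Definition geodist (x y : M) : \bar R :=
  ereal_inf [set L | exists c a b,
    [/\ c a = x, c b = y & curve_length c a b L]].

Definition geoball (x : M) (r : R) : set M := [set y | (geodist x y <= r%:E)%E].

Definition mesh_norm (X : {fset M}) : \bar R :=
  ereal_sup [set (\big[mine/+oo]_(x <- X) geodist y x)%E | y in [set: M]].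

Definition separation (X : {fset M}) : \bar R :=
  (\big[mine/+oo]_(x <- X) \big[mine/+oo]_(y <- X | x != y) geodist x y)%E.

End riemannian.

Section volume.
Variables (R : realType) (d : nat) (M : ptopologicalType).
Variables (S : smooth_manifold R d M) (g : riemannian_metric S).

Definition riemannian_volume (vol : {measure set (borel M) -> \bar R}) : Prop :=
  forall i (A : set (borel M)), measurable A -> A `<=` dom (s := S) i ->
    vol A = lebesgue_int (fun v =>
      (\1_(chart i @` A) v * Num.sqrt (\det (gram g i v)))%:E).

Definition normalized_volume (mu : probability (borel M) R) : Prop :=
  exists2 vol : {measure set (borel M) -> \bar R},
    riemannian_volume vol &
    forall A : set (borel M), measurable A ->
      mu A = ((fine (vol [set: M]))^-1%:E * vol A)%E.

End volume.

Definition asymp (R : realType) (C A B : R) : Prop := A <= C * B /\ B <= C * A.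

(* Main.v *)
(* Extend a maximal R_j-separated set greedily to a maximal R_{j+1}-separated
   one: maximality makes it an R_{j+1}-net. In an R-separated set the balls of
   radius R/3 are disjoint, each of mass at least c1 (R/3)^d, which bounds the
   cardinality from above (so the greedy extension stops); the balls of radius R
   around a net cover M, each of mass at most c2 R^d, which bounds it from below.
   Additivity of mu needs measurable balls: geodesic balls are closed because the
   geodesic distance is small near each point of the manifold topology. *)
Require Import Defs.
From HB Require Import structures.
From mathcomp Require Import all_boot all_order all_algebra finmap.
From mathcomp Require Import all_classical all_reals all_analysis.
From mathcomp Require Import measurable_realfun lra.

Set Implicit Arguments.
Unset Strict Implicit.
Unset Printing Implicit Defensive.

Import Order.TTheory GRing.Theory Num.Theory.
Import numFieldNormedType.Exports.

Local Open Scope classical_set_scope.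
Local Open Scope ring_scope.

(** * Lengths of piecewise C^1 curves: gluing, reversal, translation *)

Section curves.
Variables (R : realType) (d : nat) (M : topologicalType).
Variables (S : smooth_manifold R d M) (g : riemannian_metric S).
Implicit Types (c : R -> M) (u : R -> 'rV[R]_d) (a b e s t : R) (L : \bar R).

(** Convertible to the integrand in [curve_length_cons], so results about [speed] apply to lengths
    directly. *)
Definition speed i u t : R :=
  Num.sqrt ((derive1 u t *m gram g i (u t) *m (derive1 u t)^T) 0 0).

Lemma curve_length_le c a b L : curve_length g c a b L -> a <= b.
Proof.
by elim=> // i u {}a {}b e {}L ab _ _ _ be; exact: le_trans ab be.
Qed.

Lemma curve_length_ge0 c a b L : curve_length g c a b L -> (0 <= L)%E.
Proof.
elim=> // i u {}a {}b e {}L ab _ _ _ L0; apply: adde_ge0 => //.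
by apply: integral_ge0 => t _; rewrite lee_fin sqrtr_ge0.
Qed.

(** Each piece constrains the curve only on its own subinterval. This allows gluing two curves by a
    case distinction on time. *)
Lemma eq_curve_length c c' a b L : curve_length g c a b L ->
  (forall t, a <= t <= b -> c t = c' t) -> curve_length g c' a b L.
Proof.
elim=> [{}a _|i u {}a {}b e {}L ab uC1 cu cL IH cc'].
  exact: curve_length_pt.
have be := curve_length_le cL.
apply: curve_length_cons => //.
- move=> t /andP[at_ tb]; rewrite -cc' ?at_ ?(le_trans tb)//.
  by apply: cu; rewrite at_ tb.
- by apply: IH => t /andP[bt te]; apply: cc'; rewrite te (le_trans ab).
Qed.

Lemma curve_length_cat c a b e L L' :
  curve_length g c a b L -> curve_length g c b e L' ->
  curve_length g c a e (L + L')%E.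
Proof.
elim=> [{}a|i u {}a {}b f {}L ab uC1 cu _ IH cL']; first by rewrite add0e.
by rewrite -addeA; apply: curve_length_cons cu _ => //; exact: IH.
Qed.

Lemma derivable_rev u s t : (forall x, derivable u x 1) ->
  is_derive t 1 (fun x => u (s - x)) (- derive1 u (s - t)).
Proof.
move=> du.
have du' : is_diff (s - t) u ('d u (s - t)).
  by apply: DiffDef => //; apply/derivable1_diffP.
have ds : is_diff t (fun x : R => s - x) (fun x => 0 - x).
  exact: is_diffB.
have H := is_diff_comp ds du'.
have [Hd Hv] := H.
apply: DeriveDef; first exact/derivable1_diffP.
by rewrite deriveE// Hv /= derive1E' ?sub0r ?linearN//.
Qed.

Lemma derive1_rev u s t : (forall x, derivable u x 1) ->
  derive1 (fun x => u (s - x)) t = - derive1 u (s - t).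
Proof. by move=> du; rewrite derive1E; have [] := derivable_rev s t du. Qed.

Lemma C1_curve_rev u s : C1_curve u -> C1_curve (fun t => u (s - t)).
Proof.
move=> [du cu]; split => [t|]; first by have [] := derivable_rev s t du.
rewrite (_ : derive1 _ = (fun t => - derive1 u (s - t))); last first.
  by apply/funext => t; exact: derive1_rev.
move=> t; apply: cvgN.
apply: (@continuous_comp _ _ _ (fun x : R => s - x) (derive1 u)); last exact: cu.
by apply: cvgB => //; exact: cvg_cst.
Qed.

Lemma speed_rev i u s t : C1_curve u ->
  speed i (fun x => u (s - x)) t = speed i u (s - t).
Proof.
by move=> [du _]; rewrite /speed derive1_rev// linearN/= !mulNmx mulmxN opprK.
Qed.

(** Expanding into coordinates leaves finite sums of products. The parameter space [T] is arbitrary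
    because it is needed both along a curve and on the space of pairs (position, velocity). *)
Lemma quad_continuous (T : topologicalType) (v : T -> 'rV[R]_d)
    (A : T -> 'M[R]_d) (t : T) :
  {for t, continuous v} -> {for t, continuous A} ->
  {for t, continuous (fun x => (v x *m A x *m (v x)^T) 0 0)}.
Proof.
move=> cv cA.
have cvj j : {for t, continuous (fun x => v x 0 j)}.
  exact: (continuous_comp cv (@coord_continuous _ _ _ _ _ _)).
have cAj k j : {for t, continuous (fun x => A x k j)}.
  exact: (continuous_comp cA (@coord_continuous _ _ _ _ _ _)).
rewrite (_ : (fun x => _) =
    (fun x => \sum_j (\sum_k v x 0 k * A x k j) * v x 0 j)); last first.
  by apply/funext => x; rewrite mxE; apply: eq_bigr => j _; rewrite !mxE.
have add_cont : continuous (fun x : R * R => x.1 + x.2) by exact: add_continuous.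
apply: cvg_big => // j _; apply: cvgM; last exact: cvj.
by apply: cvg_big => // k _; apply: cvgM; [exact: cvj|exact: cAj].
Qed.

(** Continuity of [gram] is known only on the image of the chart, hence the restriction to times at
    which [u] gives the coordinates of [c]. *)
Lemma speed_continuous c i u a b : C1_curve u ->
  (forall t, a <= t <= b -> dom (s := S) i (c t) /\ chart i (c t) = u t) ->
  forall t, a <= t <= b -> {for t, continuous (speed i u)}.
Proof.
move=> [du cu] cE t tab; have [dt ut] := cE _ tab.
have cu0 : {for t, continuous u}.
  by apply: differentiable_continuous; exact/derivable1_diffP.
have cg : {for u t, continuous (gram g i)}.
  by apply: (gram_smooth g i 0%N); exists (c t).
have := @quad_continuous _ (derive1 u) (gram g i \o u) t (cu t) (continuous_comp cu0 cg).
move=> /continuous_comp; apply; exact: sqrt_continuous.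
Qed.

(** Decreasing substitution [t] to [s - t]; its derivative -1 cancels the sign in the substitution
    formula. *)
Lemma integral_rev (f : R -> R) a b s : a <= b ->
  (forall t, a <= t <= b -> {for t, continuous f}) ->
  (\int[@lebesgue_measure R]_(t in `[a, b]) (f t)%:E =
   \int[@lebesgue_measure R]_(t in `[(s - b)%R, (s - a)%R]) (f (s - t)%R)%:E)%E.
Proof.
move=> ab cf.
have D t : is_derive t 1 (fun x : R => s - x) (-1).
  by apply: is_derive_eq; rewrite add0r; exact: mul1r.
have D1 : derive1 (fun x : R => s - x) = cst (-1).
  by apply/funext => t; rewrite derive1E; have [] := D t.
have cs : continuous (fun x : R => s - x).
  by move=> x; apply: cvgB => //; exact: cvg_cst.
have := @integration_by_substitution_decreasing R (fun x => s - x) f (s - b) (s - a).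
rewrite !subKr D1 => ->.
- by apply: eq_integral => t _; rewrite !fctE opprK mulr1.
- by rewrite lerD2l lerN2.
- by move=> x y _ _ xy; rewrite ltrD2l ltrN2.
- by move=> x _; exact: cvg_cst.
- exact: is_cvg_cst.
- exact: is_cvg_cst.
- split.
  + by move=> x _; have [] := D x.
  + exact/cvg_at_right_filter/cs.
  + exact/cvg_at_left_filter/cs.
- by apply: continuous_in_subspaceT => x /[!inE]/= /[!in_itv]/=; exact: cf.
Qed.

Lemma curve_length1 c i u a b : a <= b -> C1_curve u ->
  (forall t, a <= t <= b -> dom (s := S) i (c t) /\ chart i (c t) = u t) ->
  curve_length g c a b
    (\int[@lebesgue_measure R]_(t in `[a, b]) (speed i u t)%:E)%E.
Proof.
move=> ab uC1 cu; rewrite -[X in curve_length _ _ _ _ X]adde0.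
by apply: (curve_length_cons ab uC1 cu); exact: curve_length_pt.
Qed.

(** The first piece is traversed last after reversal, so the induction appends it by concatenation;
    its length is unchanged because the quadratic form is even in the velocity. *)
Lemma curve_length_rev c a b L s : curve_length g c a b L ->
  curve_length g (fun t => c (s - t)) (s - b) (s - a) L.
Proof.
elim=> [{}a|i u {}a {}b e {}L ab uC1 cu cL IH]; first exact: curve_length_pt.
rewrite addeC; apply: curve_length_cat IH _.
rewrite (@integral_rev (speed i u) _ _ s) //; last exact: speed_continuous cu.
under eq_integral do rewrite -speed_rev//.
apply: curve_length1.
- by rewrite lerD2l lerN2.
- exact: C1_curve_rev.
- by move=> t /andP[bt ta]; apply: cu; rewrite lerBrDl -lerBrDr ta lerBlDl -lerBlDr bt.
Qed.

(** A translation of time is the composite of two reflections. *)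
Lemma curve_length_shift c a b L s : curve_length g c a b L ->
  curve_length g (fun t => c (t - s)) (a + s) (b + s) L.
Proof.
move=> /(curve_length_rev 0)/(curve_length_rev s).
rewrite !sub0r !opprK ![s + _]addrC => /eq_curve_length; apply => t _.
by rewrite sub0r opprB.
Qed.

(** * The geodesic distance and the closedness of its balls *)

Lemma geodist_refl x : geodist g x x = 0%E.
Proof.
apply/eqP; rewrite eq_le; apply/andP; split.
  apply: ge_ereal_inf; exists 0%E => //.
  by exists (cst x), 0, 0; split => //; exact: curve_length_pt.
by apply: le_ereal_inf_tmp => L [c [a [b [_ _ /curve_length_ge0]]]].
Qed.

Lemma geodist_sym x y : geodist g x y = geodist g y x.
Proof.
rewrite /geodist; congr ereal_inf; apply/seteqP.
have sub x' y' L : (exists c a b, [/\ c a = x', c b = y' & curve_length g c a b L]) ->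
    exists c a b, [/\ c a = y', c b = x' & curve_length g c a b L].
  move=> [c [a [b [ca cb /(curve_length_rev 0) cL]]]].
  exists (fun t => c (0 - t)), (0 - b), (0 - a).
  by split => //; rewrite subKr.
by split => L /=; exact: sub.
Qed.

(** A triangle inequality in strict form: strict bounds on the infima yield actual curves to
    concatenate, and infinite distances need no separate treatment. *)
Lemma geodist_lt_add x y z r s : (geodist g x y < r%:E)%E ->
  (geodist g y z < s%:E)%E -> (geodist g x z < (r + s)%:E)%E.
Proof.
move=> /ereal_inf_lt[L [c [a [b [cx cy cL]]]] Lr].
move=> /ereal_inf_lt[L' [c' [a' [b' [cy' cz cL']]]] Ls].
rewrite EFinD; apply: le_lt_trans (lteD Lr Ls).
have ab := curve_length_le cL; have ab' := curve_length_le cL'.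
(* Time shift after which the second curve starts at [b], where the first one ends. *)
pose k := b - a'.
have := curve_length_shift k cL'; rewrite /k subrKC -/k => cL'k.
pose w t := if t <= b then c t else c' (t - k).
have bb : b <= b' + k by exact: curve_length_le cL'k.
(* At [t = b] both branches take the value [y]. *)
have wb t : b <= t -> w t = c' (t - k).
  rewrite /w; case: ltgtP => // <- _.
  by rewrite cy -cy' /k subKr.
apply: ge_ereal_inf; eexists; last exact: lexx.
exists w, a, (b' + k); split.
- by rewrite /w ab.
- by rewrite wb// addrK.
- apply: curve_length_cat.
  + by apply: eq_curve_length cL _ => t /andP[_ tb]; rewrite /w tb.
  + by apply: eq_curve_length cL'k _ => t /andP[/wb ->].
Qed.

(* The straight segment from x to y in a chart has small speed, since
   w gram(v) w^T is jointly continuous in (v, w) and vanishes at w = 0. *)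
Lemma geodist_near x (e : R) : 0 < e -> \forall y \near x, (geodist g x y < e%:E)%E.
Proof.
move=> e0; have [i xi] := dom_cover S x.
pose v0 := chart i x; pose V := chart i @` dom i.
have Vv0 : nbhs v0 V.
  by apply: open_nbhs_nbhs; split; [exact: codom_open|exists x].
pose q (p : 'rV[R]_d * 'rV[R]_d) := Num.sqrt ((p.2 *m gram g i p.1 *m p.2^T) 0 0).
pose p0 : 'rV[R]_d * 'rV[R]_d := (v0, 0).
have c1 : {for p0, continuous fst} by exact: cvg_fst.
have q0 : {for p0, continuous q}.
  have cg : {for v0, continuous (gram g i)}.
    by apply: (gram_smooth g i 0%N); exists x.
  have c2 : {for p0, continuous snd} by exact: cvg_snd.
  have := quad_continuous c2 (@continuous_comp _ _ _ fst (gram g i) p0 c1 cg).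
  by move=> /continuous_comp; apply; exact: sqrt_continuous.
(* A single radius will control position and velocity together: the displacement [w] from [v0] is
   also the velocity of the segment over the unit time interval. *)
have : \forall p \near p0, V p.1 /\ q p < e / 2.
  apply: filterI; first exact: c1.
  have : q p0 < e / 2 by rewrite /q/= mul0mx mul0mx mxE sqrtr0 divr_gt0.
  exact: (cvgr_lt _ q0).
move=> /nbhs_ballP[r /= r0 rP].
have near_chart : \forall y \near x, ball v0 r (chart i y).
  by apply: (chart_continuous xi); exact: nbhsx_ballx.
have near_dom : \forall y \near x, dom i y.
  by apply: open_nbhs_nbhs; split => //; exact: dom_open.
near=> y.
have yi : dom i y by near: y.
have yr : ball v0 r (chart i y) by near: y.
pose w : 'rV[R]_d := chart i y - v0.
have wr : `|w| < r by move: yr; rewrite -ball_normE /= distrC.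
pose u (t : R) := v0 + t *: w.
have du t : is_derive t 1 u w.
  have [H1 H2] := is_diffD (is_diff_cst v0 t) (is_diff_scalel t w).
  have du : differentiable u t by [].
  apply: DeriveDef; first exact/derivable1_diffP.
  by rewrite deriveE// H2 add0r scale1r.
have u1 : derive1 u = cst w.
  by apply/funext => t; rewrite derive1E; have [] := du t.
have uC1 : C1_curve u.
  split=> [t|]; first by have [] := du t.
  by rewrite u1 => t; exact: cvg_cst.
have tw t : 0 <= t <= 1 -> V (u t) /\ q (u t, w) < e / 2.
  move=> /andP[t0 t1]; apply: (rP (_, _)); split; rewrite -ball_normE /=.
    rewrite /u opprD addNKr normrN normrZ ger0_norm//.
    by apply: le_lt_trans wr; rewrite ler_piMl.
  by rewrite sub0r normrN.
pose c t := chart_inv i (u t).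
have cu t : 0 <= t <= 1 -> dom i (c t) /\ chart i (c t) = u t.
  by move=> /tw[[z zi ztu] _]; rewrite /c -ztu chartK.
have speedq t : speed i u t = q (u t, w) by rewrite /speed u1.
(* Comparing integrals gives only a non-strict bound by [e / 2]; the halving restores strictness. *)
apply: (@le_lt_trans _ _ (e / 2)%:E); last first.
  by rewrite lte_fin gtr_pMr// invf_lt1// ltr1n.
apply: ge_ereal_inf; exists (\int[lebesgue_measure]_(t in `[0%R, 1%R]) (speed i u t)%:E)%E.
  exists c, 0, 1; split; last exact: curve_length1.
  - by rewrite /c /u scale0r addr0 chartK.
  - by rewrite /c /u scale1r subrKC chartK.
have -> : ((e / 2)%:E = \int[@lebesgue_measure R]_(t in `[0%R, 1%R]) (e / 2)%:E)%E.
  rewrite integral_cst//= lebesgue_measure_itv/= lte_fin ltr01.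
  by rewrite -EFinB subr0 mule1.
apply: ge0_le_integral => //.
- by move=> t _; rewrite lee_fin sqrtr_ge0.
- apply/measurable_EFinP; apply: subspace_continuous_measurable_fun => //.
  apply: continuous_in_subspaceT => t /[!inE]/= /[!in_itv]/=.
  exact: (speed_continuous uC1 cu).
- by move=> t /=; rewrite in_itv/= speedq lee_fin => /tw[_ /ltW].
Unshelve. all: by end_near.
Qed.

Lemma closed_geoball x r : closed (geoball g x r).
Proof.
move=> y clBy; rewrite /geoball/=; apply/lee_addgt0Pr => e e0.
have [z [xz yz]] := clBy _ (geodist_near y (divr_gt0 e0 (ltr0n R 2))).
(* One half of [e] makes the bound on the distance from [x] to [z] strict, the other half goes from
   [z] to [y]. *)
rewrite -EFinD ltW// [in (r + e)%R](splitr e) addrA.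
apply: (@geodist_lt_add _ z); last by rewrite geodist_sym.
by apply: le_lt_trans xz _; rewrite lte_fin ltrDl divr_gt0.
Qed.

End curves.

(** * Separated sets and nets: cardinality bounds and extension *)

Section nets.
Variables (R : realType) (d : nat) (M : ptopologicalType).
Variables (S : smooth_manifold R d M) (g : riemannian_metric S).
Implicit Types (X Y : {fset M}) (r : R).

Lemma measurable_geoball x r : measurable (geoball g x r : set (borel M)).
Proof.
rewrite -[X in measurable X]setCK; apply: measurableC.
by apply: sub_sigma_algebra; apply: closed_openC; exact: closed_geoball.
Qed.

Definition separated r X :=
  forall x y, x \in X -> y \in X -> x != y -> (r%:E <= geodist g x y)%E.

Definition net r X := forall y, exists2 x, x \in X & (geodist g x y <= r%:E)%E.

Lemma separation_ge r X : separated r X -> (r%:E <= separation g X)%E.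
Proof.
move=> sepX; rewrite /separation big_seq.
apply: (big_ind (fun v => r%:E <= v)%E) => [|u v ru rv|x xX]; first exact: leey.
  by rewrite le_min ru.
rewrite big_seq_cond; apply: (big_ind (fun v => r%:E <= v)%E) => [|u v ru rv|y].
- exact: leey.
- by rewrite le_min ru.
- by move=> /andP[yX xy]; exact: sepX.
Qed.

Lemma mesh_norm_le r X : net r X -> (mesh_norm g X <= r%:E)%E.
Proof.
move=> netX; apply: ge_ereal_sup => _ [y _ <-].
have [x xX xy] := netX y.
by apply: (@bigmin_inf_seq _ _ _ _ _ x) => //; rewrite geodist_sym.
Qed.

Variables (mu : probability (borel M) R) (RM c1 c2 : R).
Hypothesis c1_gt0 : 0 < c1.
Hypothesis ball_bounds : forall (x : M) (r : R), 0 < r -> r <= RM ->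
  ((c1 * r ^+ d)%:E <= mu (geoball g x r))%E /\
  (mu (geoball g x r) <= (c2 * r ^+ d)%:E)%E.

(** The balls are closed, so those of radius [r / 2] could touch; [r / 3 < r / 2] leaves room for
    the strict triangle inequality. *)
Lemma separated_disjoint r x y : 0 < r -> (r%:E <= geodist g x y)%E ->
  geoball g x (r / 3) `&` geoball g y (r / 3) = set0.
Proof.
move=> r0 rxy; apply/seteqP; split => // z [xz yz].
have r32 : r / 3 < r / 2 by rewrite ltr_pM2l// ltf_pV2 ?posrE// ltr_nat.
have lt32 u v : (geodist g u v <= (r / 3)%:E)%E -> (geodist g u v < (r / 2)%:E)%E.
  by move=> uv; apply: le_lt_trans uv _; rewrite lte_fin.
have : (geodist g x y < (r / 2 + r / 2)%:E)%E.
  by apply: (@geodist_lt_add _ _ _ _ _ _ z); [|rewrite geodist_sym]; exact: lt32.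
by rewrite -splitr ltNge rxy.
Qed.

Lemma separated_card_le r X : 0 < r -> r <= RM -> separated r X ->
  #|` X|%:R <= 3 ^+ d / c1 * r ^- d.
Proof.
move=> r0 rRM sepX.
have r30 : 0 < r / 3 by rewrite divr_gt0.
have r3RM : r / 3 <= RM.
  by apply: le_trans rRM; rewrite ler_pdivrMr// ler_peMr ?ler1n// ltW.
pose B x : set (borel M) := geoball g x (r / 3).
have : (mu (\big[setU/set0]_(x <- X) B x) <= 1)%E.
  by apply: probability_le1; apply: bigsetU_measurable => x _; exact: measurable_geoball.
rewrite measure_fbigsetU//; last 2 first.
- by move=> x _; exact: measurable_geoball.
- move=> x y /= xX yX Bxy; apply/eqP/negPn/negP => xy.
  have := separated_disjoint r0 (sepX _ _ xX yX xy).
  by move: Bxy => [z Bz] E; rewrite -/(B x) -/(B y) in E; rewrite E in Bz.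
have : (\sum_(x <- X) (c1 * (r / 3) ^+ d)%:E <= \sum_(x <- X) mu (B x))%E.
  by apply: lee_sum => x _; have [] := ball_bounds x r30 r3RM.
move=> /le_trans h /h.
rewrite sumEFin lee_fin big_const_seq count_predT iter_addr_0.
rewrite -[_ *+ #|` X|]mulr_natl -ler_pdivlMr ?mulr_gt0 ?exprn_gt0// => le1.
apply: le_trans le1 _.
by rewrite mul1r expr_div_n !invfM invrK mulrA mulrC mulrA.
Qed.

Lemma net_card_ge r X : 0 < r -> r <= RM -> net r X -> r ^- d <= c2 * #|` X|%:R.
Proof.
move=> r0 rRM netX.
pose B x : set (borel M) := geoball g x r.
have : (1 <= \sum_(x <- X) mu (B x))%E.
  rewrite -(probability_setT mu).
  apply: (@le_trans _ _ (mu (\big[setU/set0]_(x <- X) B x))).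
    rewrite (_ : \big[setU/set0]_(x <- X) B x = setT)//; apply/seteqP; split => // y _.
    have [x xX xy] := netX y.
    by rewrite -bigcup_seq; exists x.
  (* The balls of a net may overlap, so only finite subadditivity is available here. *)
  elim: (enum_fset X) => [|x s IH]; first by rewrite !big_nil measure0.
  rewrite !big_cons; apply: le_trans (leeD2l _ IH).
  apply: measureU2; first exact: measurable_geoball.
  by apply: bigsetU_measurable => z _; exact: measurable_geoball.
have : (\sum_(x <- X) mu (B x) <= \sum_(x <- X) (c2 * r ^+ d)%:E)%E.
  by apply: lee_sum => x _; have [] := ball_bounds x r0 rRM.
move=> h /le_trans/(_ h).
rewrite sumEFin lee_fin big_const_seq count_predT iter_addr_0 -[_ *+ #|` X|]mulr_natr => le1.
by rewrite -[X in X <= _]mul1r ler_pdivrMr ?exprn_gt0// mulrAC.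
Qed.

Lemma separated_extend r X : 0 < r -> r <= RM -> separated r X ->
  exists Y, [/\ (X `<=` Y)%fset, separated r Y & net r Y].
Proof.
move=> r0 rRM.
pose N := Num.bound `|3 ^+ d / c1 * r ^- d|.
have cardN Z : separated r Z -> (#|` Z| <= N)%N.
  move=> /(separated_card_le r0 rRM) h.
  rewrite -(ler_nat R); apply: le_trans h _; apply: le_trans (ler_norm _) _.
  exact/ltW/archi_boundP/normr_ge0.
have [n] := ubnP (N - #|` X|); elim: n X => // n IH X Xn sepX.
have [netX|] := pselect (net r X); first by exists X.
move=> /existsNP[y yX].
have far x : x \in X -> (r%:E < geodist g x y)%E.
  by move=> xX; rewrite ltNge; apply/negP => xy; apply: yX; exists x.
have yNX : y \notin X.
  by apply/negP => /far; rewrite geodist_refl lte_fin ltNge ltW.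
have sepY : separated r (y |` X)%fset.
  move=> x z /fset1UP[->|xX] /fset1UP[->|zX].
  - by rewrite eqxx.
  - by move=> _; rewrite geodist_sym ltW// far.
  - by move=> _; rewrite ltW// far.
  - exact: sepX.
have [|Y [XY sY nY]] := IH (y |` X)%fset _ sepY.
  have := cardN _ sepY; rewrite cardfsU1 yNX add1n => XN.
  by rewrite -ltnS subnSK.
by exists Y; split => //; apply: fsubset_trans XY; exact: fsubsetU1.
Qed.
End nets.

(** * Construction of the nested sequence *)

Theorem lemma3p1 (R : realType) (d : nat) (M : ptopologicalType)
    (S : smooth_manifold R d M) (g : riemannian_metric S)
    (M_compact : compact [set: M]) (M_connected : connected [set: M])
    (mu : probability (borel M) R) (mu_volume : normalized_volume g mu)
    (RM c1 c2 : R) (RM_gt0 : 0 < RM) (c1_gt0 : 0 < c1) (c2_gt0 : 0 < c2)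
    (ball_bounds : forall (x : M) (r : R), 0 < r -> r <= RM ->
      ((c1 * r ^+ d)%:E <= mu (geoball g x r))%E /\
      (mu (geoball g x r) <= (c2 * r ^+ d)%:E)%E) :
  exists C : R, 0 < C /\
  forall gamma : R, 0 < gamma -> gamma < RM ->
  let n (j : nat) : R := 2 ^+ j in
  let r (j : nat) : R := gamma * (n j)^-1 in
  exists X : nat -> {fset M}, forall j : nat,
    [/\ (X j `<=` X j.+1)%fset,
        (mesh_norm g (X j) <= (r j)%:E)%E,
        ((r j)%:E <= separation g (X j))%E,
        asymp C (#|` X j|%:R) (r j ^- d) &
        asymp C (r j ^- d) (gamma ^- d * 2 ^+ (j * d))].
Proof.
(* The summands serve, in order, the comparison with [gamma], the upper and the lower cardinality
   bound. [C] is fixed before [gamma], hence independent of it. *)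
pose C := 1 + 3 ^+ d / c1 + c2.
have a0 : 0 <= 3 ^+ d / c1 by rewrite divr_ge0 ?exprn_ge0 ?ltW.
have C1 : 1 <= C by rewrite /C -addrA lerDl addr_ge0// ltW.
exists C; split; first exact: lt_le_trans C1.
move=> gamma gamma0 gammaRM n r.
have r_gt0 j : 0 < r j by rewrite mulr_gt0// invr_gt0 exprn_gt0.
have r_noninc j : r j.+1 <= r j.
  by rewrite ler_pM2l// lef_pV2 ?posrE ?exprn_gt0// ler_eXn2l ?ltr1n.
have r_le j : r j <= RM.
  apply: le_trans (ltW gammaRM); elim: j => [|j]; first by rewrite /r /n expr0 invr1 mulr1.
  exact: le_trans.
(* Separation is placed under the existential so that the extension [F] is a total function; on a
   set that is not separated its value is arbitrary. *)
have /choice[F FP] (p : nat * {fset M}) : exists Y, separated g (r p.1) p.2 ->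
    [/\ (p.2 `<=` Y)%fset, separated g (r p.1) Y & net g (r p.1) Y].
  case: p => j X.
  have [sX|nsX] := pselect (separated g (r j) X); last by exists X.
  have [Y HY] := separated_extend c1_gt0 ball_bounds (r_gt0 j) (r_le j) sX.
  by exists Y.
pose X := fix X j := if j is j'.+1 then F (j, X j') else F (0%N, fset0).
(* Radii decrease, so each stage is admissible input for the next extension. *)
have sepX_next j Y : separated g (r j) Y -> separated g (r j.+1) Y.
  move=> sY x y xY yY xy; apply: le_trans (sY _ _ xY yY xy).
  by rewrite lee_fin.
have XP j : separated g (r j) (X j) /\ net g (r j) (X j).
  elim: j => [|j [sX _]].
    have sep0 : separated g (r 0%N) (fset0 : {fset M}) by [].
    by have [] := FP (0%N, fset0) sep0.
  by have [] := FP (j.+1, X j) (sepX_next _ _ sX).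
exists X => j; have [sX nX] := XP j.
have rd0 : 0 < r j ^- d by rewrite invr_gt0 exprn_gt0.
(* The second comparison is an equality, so any constant at least 1 suffices. *)
have rdE : r j ^- d = gamma ^- d * 2 ^+ (j * d).
  by rewrite /r /n exprMn invfM exprVn invrK -exprM.
split.
- by have [] := FP (j.+1, X j) (sepX_next _ _ sX).
- exact: mesh_norm_le.
- exact: separation_ge.
- split.
  + apply: le_trans (separated_card_le c1_gt0 ball_bounds (r_gt0 j) (r_le j) sX) _.
    by rewrite ler_pM2r// /C; lra.
  + apply: le_trans (net_card_ge ball_bounds (r_gt0 j) (r_le j) nX) _.
    by rewrite ler_wpM2r// /C; lra.
- by rewrite -rdE; split; rewrite ler_peMl// ltW.
Qed.
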